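(* Let $G=SL(2,\mathbb{C})$, let $\Gamma$ be a finitely generated group with fixed generators $\bar{\epsilon}_1,\dots,\bar{\epsilon}_n$, let $\rho:\Gamma\to G$ be a representation and $A=(A_1,\dots,A_n)=(\rho(\bar{\epsilon}_1),\dots,\rho(\bar{\epsilon}_n))\in G^{\times n}$. The following are equivalent: (i) $A$ is stable; (ii) there exist $1\le j,k,l\le n$ such that $(\rho(\bar{\epsilon}_j),\rho(\bar{\epsilon}_k),\rho(\bar{\epsilon}_l))\in G^{\times3}$ is stable; (iii) there exist $1\le j,k,l\le n$ such that $\sigma_{jk}(A)\neq0$ or $\Delta_{jkl}(A)\neq0$; (iv) $A$ is not similar to an upper triangular $n$-matrix; (v) $\rho$ is irreducible.
   Context: $G$ acts on $G^{\times n}$ by simultaneous conjugation $g\cdot A=(gA_1g^{-1},\dots,gA_ng^{-1})$; a point is stable if its orbit map $G\to G^{\times n}$ is proper. Similar means conjugate by a common element of $GL(2,\mathbb{C})$; upper triangular $n$-matrix means all components upper triangular. $\sigma_{jk}(A)=\mathsf{tr}(A_jA_kA_j^{-1}A_k^{-1})-2$ and $\Delta_{jkl}(A)=(\mathsf{tr}(A_jA_kA_l)-\mathsf{tr}(A_lA_kA_j))^2$. $\rho$ is irreducible if no proper nonzero subspace of $\mathbb{C}^2$ is invariant under $\rho(\Gamma)$. *)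

(* Defs.v *)
From HB Require Import structures.
From mathcomp Require Export all_boot all_order all_algebra.
From mathcomp Require Export all_classical all_reals all_analysis.
From mathcomp Require Export complex.
Export numFieldTopology.Exports numFieldNormedType.Exports.

Set Implicit Arguments.
Unset Strict Implicit.
Unset Printing Implicit Defensive.

Import Order.TTheory GRing.Theory Num.Theory.
Local Open Scope ring_scope.
Local Open Scope classical_set_scope.

(* The usual (norm) topology of C = R[i] (taken from the regular copy). *)
HB.instance Definition _ (R : realType) := PseudoPointedMetric.copy R[i] R[i]^o.

Section Defs.
Context {R : realType}.
Local Notation C := R[i].

Definition SL2 : set 'M[C]_2 := [set g | \det g = 1].

Definition SL2n (n : nat) : set {ptws 'I_n -> 'M[C]_2} :=
  [set A | forall i, SL2 (A i)].

Definition orbit_map (n : nat) (A : 'I_n -> 'M[C]_2) :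
  'M[C]_2 -> {ptws 'I_n -> 'M[C]_2} :=
  fun g => fun i => g *m A i *m invmx g.

(* f : D -> E (D, E with subspace topologies) is proper:
   preimages of compact subsets of E are compact. *)
Definition proper_on {X Y : topologicalType} (D : set X) (E : set Y)
  (f : X -> Y) : Prop :=
  forall K : set Y, compact K -> K `<=` E -> compact (D `&` f @^-1` K).

Definition stable (n : nat) (A : 'I_n -> 'M[C]_2) : Prop :=
  proper_on SL2 (@SL2n n) (orbit_map A).

Definition triple (a b c : 'M[C]_2) : 'I_3 -> 'M[C]_2 :=
  fun t => nth a [:: a; b; c] t.

Definition sigma (n : nat) (A : 'I_n -> 'M[C]_2) (j k : 'I_n) : C :=
  \tr (A j *m A k *m invmx (A j) *m invmx (A k)) - 2.

Definition Delta (n : nat) (A : 'I_n -> 'M[C]_2) (j k l : 'I_n) : C :=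
  (\tr (A j *m A k *m A l) - \tr (A l *m A k *m A j)) ^+ 2.

Definition upper_triangular (M : 'M[C]_2) : Prop :=
  forall i j : 'I_2, (j < i)%N -> M i j = 0.

Definition similar_to_upper_triangular (n : nat) (A : 'I_n -> 'M[C]_2) : Prop :=
  exists2 g : 'M[C]_2, g \in unitmx &
    forall i, upper_triangular (g *m A i *m invmx g).

Definition generates (Gamma : groupType) (n : nat) (eps : 'I_n -> Gamma) : Prop :=
  forall P : set Gamma,
    P 1%g ->
    (forall x y, P x -> P y -> P (x * y)%g) ->
    (forall x, P x -> P (x^-1)%g) ->
    (forall i, P (eps i)) ->
    forall g, P g.

Definition SL2_representation (Gamma : groupType) (rho : Gamma -> 'M[C]_2) : Prop :=
  [/\ rho 1%g = 1%:M,
      forall x y, rho (x * y)%g = rho x *m rho y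
    & forall x, SL2 (rho x)].

Definition irreducible_rep (Gamma : groupType) (rho : Gamma -> 'M[C]_2) : Prop :=
  ~ exists W : {vspace 'cV[C]_2},
      [/\ W != 0%VS, W != fullv &
          forall (g : Gamma) (v : 'cV[C]_2), v \in W -> rho g *m v \in W].

End Defs.

(* Main.v *)
(* All conditions are compared with the absence of a common left eigenvector of
   the A_i, i.e. of a common nonzero root of the binary quadratic forms
   q_i(x, y) = x^2 b_i + x y (d_i - a_i) - y^2 c_i, A_i = [[a_i, b_i], [c_i, d_i]].

   Stability: for h in SL2 with rows u, v, the off-diagonal entries of
   h A_i h^-1 are q_i(u) and - q_i(v).  If the q_i have no common root, then by
   compactness sum_i |q_i(u)|^2 >= m |u|^4 for some m > 0, so a compact set of
   values h A bounds h.  If they have one, A is conjugated to upper triangular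
   form, and the curve diag(t, 1/t), t -> 0, leaves every compact set while it
   conjugates A inside a compact arc.

   Invariants: sigma_jk = - det N and tr(A_j A_k A_l) - tr(A_l A_k A_j) =
   tr(N A_l), where N = [A_j, A_k].  If all of them vanish and some N is nonzero,
   then N = w phi has rank one with phi(w) = tr N = 0, and phi (A_l w) =
   tr(N A_l) = 0 says that phi is a common left eigenvector.  If all A_i commute,
   an eigenvector of a nonscalar A_j is one for all of them. *)

Require Import Defs.
From HB Require Import structures.
From mathcomp Require Import all_boot all_order all_algebra.
From mathcomp Require Import all_classical all_reals all_analysis.
From mathcomp Require Import complex ring lra.
Import numFieldTopology.Exports numFieldNormedType.Exports.
Set Implicit Arguments.
Unset Strict Implicit.
Unset Printing Implicit Defensive.
Import Order.TTheory GRing.Theory Num.Theory.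
Local Open Scope ring_scope.
Local Open Scope classical_set_scope.
Local Open Scope complex_scope.

(** * Matrices of size two over a field: eigenforms, commutators and traces *)

Section Algebra.
Variable F : fieldType.
Implicit Types X Y Z g : 'M[F]_2.

Definition mx2 (a b c d : F) : 'M[F]_2 :=
  \matrix_(i, j) if i == 0 then (if j == 0 then a else b)
                 else (if j == 0 then c else d).

Lemma mx2P X : X = mx2 (X 0 0) (X 0 1) (X 1 0) (X 1 1).
Proof.
apply/matrixP => -[[|[|//]] i] [[|[|//]] j]; rewrite mxE /=;
  by congr (X _ _); apply/val_inj.
Qed.

Lemma mx2E a b c d :
  (mx2 a b c d 0 0 = a) * (mx2 a b c d 0 1 = b) *
  (mx2 a b c d 1 0 = c) * (mx2 a b c d 1 1 = d).
Proof. by rewrite !mxE. Qed.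

Lemma mul_mx2 a b c d a' b' c' d' :
  mx2 a b c d *m mx2 a' b' c' d' =
  mx2 (a * a' + b * c') (a * b' + b * d') (c * a' + d * c') (c * b' + d * d').
Proof. by rewrite [LHS]mx2P !mxE !big_ord_recl !big_ord0 !mxE /= !addr0. Qed.

Lemma sub_mx2 a b c d a' b' c' d' :
  mx2 a b c d - mx2 a' b' c' d' = mx2 (a - a') (b - b') (c - c') (d - d').
Proof. by rewrite [LHS]mx2P !mxE. Qed.

Lemma det_mx2 a b c d : \det (mx2 a b c d) = a * d - b * c.
Proof.
rewrite (expand_det_row _ 0) !big_ord_recl big_ord0 /cofactor !det_mx11 !mxE /=.
by rewrite expr0 expr1 mul1r mulN1r mulrN addr0.
Qed.

Lemma adj_mx2 a b c d : \adj (mx2 a b c d) = mx2 d (- b) (- c) a.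
Proof.
rewrite [LHS]mx2P !mxE /cofactor !det_mx11 !mxE /=.
rewrite !(modn_small (isT : 1 < 2)%N).
by congr mx2; ring.
Qed.

Lemma trace_mx2 a b c d : \tr (mx2 a b c d) = a + d.
Proof. by rewrite /mxtrace !big_ord_recl big_ord0 !mxE addr0. Qed.

Lemma invmx_adj g : \det g = 1 -> invmx g = \adj g.
Proof. by move=> d1; rewrite /invmx unitmxE d1 unitr1 invr1 scale1r. Qed.

(* Vanishes at [(x, y)] iff [X] maps the row vector [(x, y)] to a multiple of
   itself. *)
Definition eigenform X (x y : F) : F :=
  x ^+ 2 * X 0 1 + x * y * (X 1 1 - X 0 0) - y ^+ 2 * X 1 0.

Lemma conj_adj01 g X :
  (g *m X *m \adj g) 0 1 = eigenform X (g 0 0) (g 0 1).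
Proof.
rewrite /eigenform [g]mx2P [X]mx2P adj_mx2 !mul_mx2 !mx2E; ring.
Qed.

Lemma conj_adj10 g X :
  (g *m X *m \adj g) 1 0 = - eigenform X (g 1 0) (g 1 1).
Proof.
rewrite /eigenform [g]mx2P [X]mx2P adj_mx2 !mul_mx2 !mx2E; ring.
Qed.

Definition common_eigenrow (I : Type) (A : I -> 'M[F]_2) : Prop :=
  exists x y : F, [/\ (x != 0) || (y != 0) & forall i, eigenform (A i) x y = 0].

(** The eigenrow is completed to a matrix of determinant 1 as its second row; [conj_adj10] then
    turns the eigenform into the lower left entry of the conjugate. *)
Lemma common_eigenrow_SL2 (I : Type) (A : I -> 'M[F]_2) :
  common_eigenrow A ->
  exists2 g, \det g = 1 & forall i, (g *m A i *m \adj g) 1 0 = 0.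
Proof.
move=> [x [y [xy0 Axy]]].
have [y0|y0] := eqVneq y 0.
  rewrite y0 eqxx orbF in xy0.
  exists (mx2 0 (- x^-1) x y) => [|i]; last by rewrite conj_adj10 !mx2E Axy oppr0.
  by rewrite det_mx2 mul0r sub0r mulNr opprK mulVf.
exists (mx2 y^-1 0 x y) => [|i]; last by rewrite conj_adj10 !mx2E Axy oppr0.
by rewrite det_mx2 mul0r subr0 mulVf.
Qed.

Lemma det_commutator X Y : \det X = 1 -> \det Y = 1 ->
  \tr (X *m Y *m invmx X *m invmx Y) - 2 = - \det (X *m Y - Y *m X).
Proof.
move=> dX dY; rewrite !invmx_adj //.
have <- : 2 * (\det X * \det Y) = 2 by rewrite dX dY !mulr1.
clear dX dY.
rewrite [X]mx2P [Y]mx2P !adj_mx2 !mul_mx2 trace_mx2 !det_mx2.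
rewrite sub_mx2 det_mx2; ring.
Qed.

Lemma trace_commutator X Y Z :
  \tr (X *m Y *m Z) - \tr (Z *m Y *m X) = \tr ((X *m Y - Y *m X) *m Z).
Proof. by rewrite mulmxBl raddfB -[Z *m Y *m X]mulmxA (mxtrace_mulC Z). Qed.

(** Such an [N] has rank at most one and square zero, and N Z N = tr(N Z) N = 0. So [N] kills both u
    and u Z for a row u of [N], which makes u Z a multiple of u when u is nonzero. Both rows are
    treated because one of them may vanish. *)
Lemma traceless_singular_eigenform N Z :
  \tr N = 0 -> \det N = 0 -> \tr (N *m Z) = 0 ->
  eigenform Z (N 0 0) (N 0 1) = 0 /\ eigenform Z (N 1 0) (N 1 1) = 0.
Proof.
rewrite /eigenform [N]mx2P [Z]mx2P mul_mx2 !trace_mx2 det_mx2 !mx2E.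
move=> /eqP; rewrite addrC addr_eq0 => /eqP -> detN trNZ; split.
  (* The eigenform is a combination of the determinant of [N] and the trace of [N *m Z], once
     [N 1 1] is replaced by [- N 0 0]. *)
  transitivity (- (N 0 0 * - N 0 0 - N 0 1 * N 1 0) * Z 0 1
    - N 0 1 * (N 0 0 * Z 0 0 + N 0 1 * Z 1 0 + (N 1 0 * Z 0 1 + - N 0 0 * Z 1 1))).
    by ring.
  by rewrite detN trNZ oppr0 mul0r mulr0 subr0.
transitivity ((N 0 0 * - N 0 0 - N 0 1 * N 1 0) * Z 1 0
  + N 1 0 * (N 0 0 * Z 0 0 + N 0 1 * Z 1 0 + (N 1 0 * Z 0 1 + - N 0 0 * Z 1 1))).
  by ring.
by rewrite detN trNZ mul0r mulr0 addr0.
Qed.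

(* If [X] and [Y] commute, their eigenforms are proportional. *)
Lemma commuting_eigenform X Y x y x' y' : X *m Y = Y *m X ->
  eigenform X x' y' != 0 -> eigenform X x y = 0 -> eigenform Y x y = 0.
Proof.
move=> XY nX qX; apply: (mulfI nX); rewrite mulr0.
have E i j : (X *m Y) i j - (Y *m X) i j = 0 by rewrite XY subrr.
have E0 := E 0 0; have E1 := E 0 1; have E2 := E 1 0.
rewrite [X]mx2P [Y]mx2P !mul_mx2 !mx2E in E0 E1 E2.
transitivity (eigenform Y x' y' * eigenform X x y); last by rewrite qX mulr0.
apply/eqP; rewrite -subr_eq0; apply/eqP.
(* The three zeros stand for the commutator entries in [E1], [E0], [E2]. Up to sign these are the 2
   by 2 minors of the coefficients of the two forms. *)
transitivity (0 * (x' ^+ 2 * x * y - x' * y' * x ^+ 2)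
  + 0 * (y' ^+ 2 * x ^+ 2 - x' ^+ 2 * y ^+ 2)
  + 0 * (y' ^+ 2 * x * y - x' * y' * y ^+ 2)); last by rewrite !mul0r !addr0.
by rewrite -{1}E1 -{1}E0 -E2 /eigenform; ring.
Qed.

(* Spans the column vectors annihilated by the row vector [(x, y)]. *)
Definition eigencol (x y : F) : 'cV[F]_2 := \col_i (if i == 0 then - y else x).

Lemma eigencol_eq0 x y : (eigencol x y == 0) = (x == 0) && (y == 0).
Proof.
apply/eqP/andP => [e|[/eqP-> /eqP->]].
  have := congr1 (fun v : 'cV[F]_2 => v 0 0) e; rewrite !mxE /= => /eqP.
  have := congr1 (fun v : 'cV[F]_2 => v 1 0) e; rewrite !mxE /= => ->.
  by rewrite oppr_eq0 eqxx.
by apply/colP => i; rewrite !mxE oppr0 if_same.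
Qed.

Lemma eigencolE (v : 'cV[F]_2) : v = eigencol (v 1 0) (- v 0 0).
Proof.
apply/colP => -[[|[|//]] i]; rewrite mxE /= ?opprK; congr (v _ _); exact: val_inj.
Qed.

Lemma mul_mx2_eigencol X x y :
  X *m eigencol x y = eigencol (X 1 1 * x - X 1 0 * y) (X 0 0 * y - X 0 1 * x).
Proof.
rewrite [LHS]eigencolE !mxE !big_ord_recl !big_ord0 !mxE /=.
have -> : lift 0 0 = 1 :> 'I_2 by apply: val_inj.
by congr eigencol; ring.
Qed.

(** In dimension two a row is an eigenrow exactly when the line it annihilates is invariant. This
    passes from rows, natural for conjugation, to columns, on which representations act. *)
Lemma eigenformP X x y : (x != 0) || (y != 0) ->
  eigenform X x y = 0 <-> exists l, X *m eigencol x y = l *: eigencol x y.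
Proof.
move=> xy0; rewrite mul_mx2_eigencol /eigenform.
have scE l : l *: eigencol x y = eigencol (l * x) (l * y).
  by apply/colP => i; rewrite !mxE; case: ifP; rewrite ?mulrN.
split=> [q0|[l]]; last first.
  rewrite scE => e.
  have := congr1 (fun v : 'cV[F]_2 => v 0 0) e; rewrite !mxE /= => /oppr_inj e0.
  have := congr1 (fun v : 'cV[F]_2 => v 1 0) e; rewrite !mxE /= => e1.
  transitivity (y * (X 1 1 * x - X 1 0 * y) - x * (X 0 0 * y - X 0 1 * x)).
    by ring.
  by rewrite e0 e1; ring.
have {}q0 : y * (X 1 1 * x - X 1 0 * y) = x * (X 0 0 * y - X 0 1 * x).
  by apply/eqP; rewrite -subr_eq0 -q0; apply/eqP; ring.
have [x0|x0] := eqVneq x 0.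
  rewrite x0 eqxx /= in xy0.
  exists ((X 0 0 * y - X 0 1 * x) / y); rewrite scE.
  congr eigencol; last by rewrite divfK.
  by apply: (mulfI xy0); rewrite q0; field.
exists ((X 1 1 * x - X 1 0 * y) / x); rewrite scE.
congr eigencol; first by rewrite divfK.
by apply: (mulfI x0); rewrite -q0; field.
Qed.

(** The eigenvalue is a root of the characteristic polynomial. In this form it determines the trace
    from a nonzero eigenvalue and the determinant. *)
Lemma eigencol_trace X x y l : (x != 0) || (y != 0) ->
  X *m eigencol x y = l *: eigencol x y -> l * \tr X = l ^+ 2 + \det X.
Proof.
move=> xy0 e; apply/eqP; rewrite -subr_eq0.
have e0 : X 0 0 * y - X 0 1 * x = l * y.
  have := congr1 (fun v : 'cV[F]_2 => v 0 0) e.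
  by rewrite mul_mx2_eigencol !mxE /= mulrN => /oppr_inj.
have e1 : X 1 1 * x - X 1 0 * y = l * x.
  by have := congr1 (fun v : 'cV[F]_2 => v 1 0) e; rewrite mul_mx2_eigencol !mxE /=.
rewrite [X]mx2P trace_mx2 det_mx2.
(* [D] is minus the determinant of X - l. Multiplying the eigenvector equations by the adjugate of X
   - l shows that [D] kills both coordinates. *)
set D := (D in D == 0).
have xD : x * D = 0.
  transitivity (- (X 0 0 - l) * (X 1 1 * x - X 1 0 * y - l * x)
    - X 1 0 * (X 0 0 * y - X 0 1 * x - l * y)); first by rewrite /D; ring.
  by rewrite e0 e1 !subrr !mulr0 subr0.
have yD : y * D = 0.
  transitivity (- (X 1 1 - l) * (X 0 0 * y - X 0 1 * x - l * y)
    - X 0 1 * (X 1 1 * x - X 1 0 * y - l * x)); first by rewrite /D; ring.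
  by rewrite e0 e1 !subrr !mulr0 subr0.
by case/orP: xy0 => n0; apply/eqP/(mulfI n0); rewrite mulr0.
Qed.

(** On the common eigencolumn the group commutator acts by 1, while both triple products act by the
    same scalar abc. Having determinant 1, matrices with a common eigenvalue have equal traces. *)
Lemma upper_triangular_invariants X Y Z x y : (x != 0) || (y != 0) ->
  \det X = 1 -> \det Y = 1 -> \det Z = 1 ->
  eigenform X x y = 0 -> eigenform Y x y = 0 -> eigenform Z x y = 0 ->
  \tr (X *m Y *m invmx X *m invmx Y) = 2 /\
  \tr (X *m Y *m Z) = \tr (Z *m Y *m X).
Proof.
move=> xy0 dX dY dZ /(eigenformP _ xy0)[a Xa].
move=> /(eigenformP _ xy0)[b Yb] /(eigenformP _ xy0)[c Zc].
have v0 : eigencol x y != 0 by rewrite eigencol_eq0 negb_and.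
have unitS (W : 'M[F]_2) : \det W = 1 -> W \in unitmx.
  by rewrite unitmxE => ->; exact: unitr1.
have n0 (W : 'M[F]_2) l : \det W = 1 ->
    W *m eigencol x y = l *: eigencol x y -> l != 0.
  move=> dW Wl; apply: contra_eq_neq Wl => ->; rewrite scale0r.
  by apply: contra_neq v0 => e; rewrite -[eigencol x y](mulKmx (unitS _ dW)) e mulmx0.
have inv (W : 'M[F]_2) l : \det W = 1 -> W *m eigencol x y = l *: eigencol x y ->
    invmx W *m eigencol x y = l^-1 *: eigencol x y.
  move=> dW Wl; have l0 := n0 _ _ dW Wl.
  apply: (scalerI l0); rewrite scalerA mulfV // scale1r.
  by rewrite scalemxAr -Wl mulKmx // unitS.
split.
  have e : X *m Y *m invmx X *m invmx Y *m eigencol x y = 1 *: eigencol x y.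
    rewrite -!mulmxA (inv _ _ dY Yb) -scalemxAr (inv _ _ dX Xa) -!scalemxAr Yb.
    rewrite -!scalemxAr Xa !scalerA; congr (_ *: _).
    by field; rewrite (n0 _ _ dX Xa) (n0 _ _ dY Yb).
  have := eigencol_trace xy0 e.
  by rewrite !det_mulmx !det_inv dX dY invr1 !mulr1 mul1r expr1n => ->.
have e1 : X *m Y *m Z *m eigencol x y = (a * b * c) *: eigencol x y.
  by rewrite -!mulmxA Zc -!scalemxAr Yb -!scalemxAr Xa !scalerA; congr (_ *: _); ring.
have e2 : Z *m Y *m X *m eigencol x y = (a * b * c) *: eigencol x y.
  by rewrite -!mulmxA Xa -!scalemxAr Yb -!scalemxAr Zc !scalerA; congr (_ *: _); ring.
have abc : a * b * c != 0.
  by rewrite !mulf_neq0 ?(n0 _ _ dX Xa) ?(n0 _ _ dY Yb) ?(n0 _ _ dZ Zc).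
apply: (mulfI abc); rewrite (eigencol_trace xy0 e1) (eigencol_trace xy0 e2).
by rewrite !det_mulmx dX dY dZ.
Qed.

End Algebra.

(** * Existence of a common eigenrow over an algebraically closed field *)

Lemma eigenform_root (F : numClosedFieldType) (X : 'M[F]_2) :
  exists x y, (x != 0) || (y != 0) /\ eigenform X x y = 0.
Proof.
have [X01|X01] := eqVneq (X 0 1) 0.
  by exists 1, 0; rewrite oner_eq0 /eigenform X01; split=> //; ring.
(* The quadratic formula for x / y, with [d] the discriminant of the eigenform. *)
pose d := (X 1 1 - X 0 0) ^+ 2 + 4 * X 0 1 * X 1 0.
exists (sqrtC d - (X 1 1 - X 0 0)), (2 * X 0 1); split.
  by rewrite mulf_neq0 ?pnatr_eq0 ?orbT.
transitivity (X 0 1 * (sqrtC d ^+ 2 - d)); first by rewrite /d /eigenform; ring.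
by rewrite sqrtCK subrr mulr0.
Qed.

Lemma common_eigenrow_of_invariants (F : numClosedFieldType) (n : nat)
    (A : 'I_n -> 'M[F]_2) :
  (forall i, \det (A i) = 1) ->
  (forall j k, \tr (A j *m A k *m invmx (A j) *m invmx (A k)) = 2) ->
  (forall j k l, \tr (A j *m A k *m A l) = \tr (A l *m A k *m A j)) ->
  common_eigenrow A.
Proof.
move=> detA trA2 trA3.
have [/forallP comm|] :=
  boolP [forall j, forall k, A j *m A k == A k *m A j]; last first.
  rewrite negb_forall => /existsP[j]; rewrite negb_forall => /existsP[k].
  rewrite -subr_eq0; set N := _ - _ => N0.
  have detN : \det N = 0.
    by apply/eqP; rewrite -oppr_eq0 -det_commutator // trA2 subrr.
  have trN : \tr N = 0 by rewrite raddfB /= mxtrace_mulC subrr.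
  have NA l : \tr (N *m A l) = 0 by rewrite -trace_commutator trA3 subrr.
  (* Any nonzero row of [N] is a common eigenrow; if the first row vanishes, the second does not. *)
  have [r0|r0] := boolP ((N 0 0 != 0) || (N 0 1 != 0)).
    exists (N 0 0), (N 0 1); split=> // i.
    by have [] := traceless_singular_eigenform trN detN (NA i).
  exists (N 1 0), (N 1 1); split=> [|i]; last first.
    by have [] := traceless_singular_eigenform trN detN (NA i).
  apply: contraNT N0; move: r0; rewrite -!negb_and !negbK.
  move=> /andP[/eqP a0 /eqP b0] /andP[/eqP c0 /eqP d0].
  by rewrite [N]mx2P a0 b0 c0 d0; apply/eqP/matrixP => i j'; rewrite !mxE !if_same.
have {}comm j k : A j *m A k = A k *m A j by apply/eqP; move: k; apply/forallP/comm.
(* Either some [A j] is not scalar, and a root of its form is shared by all the commuting matrices,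
   or every form vanishes identically and any row will do. *)
have [[j [x' [y' nj]]]|all0] :=
  pselect (exists j x' y', eigenform (A j) x' y' != 0).
  have [x [y [xy0 jxy]]] := eigenform_root (A j).
  by exists x, y; split=> // i; apply: commuting_eigenform nj jxy.
exists 1, 0; rewrite oner_eq0; split=> // i; apply/eqP/negPn/negP => ni.
by apply: all0; exists i, 1, 0.
Qed.

(** * Triangularizability, invariant lines and irreducibility *)

Section Irreducibility.
Variables (R : realType) (n : nat).
Local Notation C := R[i].

(** The second row of the conjugating matrix is the eigenrow. As that matrix is only invertible, the
    adjugate formula carries the factor 1 / det g. *)
Lemma similar_common_eigenrow (A : 'I_n -> 'M[C]_2) :
  similar_to_upper_triangular A -> common_eigenrow A.
Proof.
move=> [g gu up]; exists (g 1 0), (g 1 1); split.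
  apply: contraTT gu; rewrite -negb_and negbK => /andP[/eqP g10 /eqP g11].
  by rewrite unitmxE [g]mx2P det_mx2 g10 g11 !mulr0 subrr unitr0.
move=> i; have := up i 1 0 isT; rewrite /invmx gu -scalemxAr mxE conj_adj10.
move=> /eqP; rewrite mulrN oppr_eq0 mulf_eq0 invr_eq0 => /orP[/eqP d0|/eqP //].
by rewrite unitmxE d0 unitr0 in gu.
Qed.

Lemma common_eigenrow_similar (A : 'I_n -> 'M[C]_2) :
  common_eigenrow A -> similar_to_upper_triangular A.
Proof.
move=> /common_eigenrow_SL2[g g1 gA]; exists g; first by rewrite unitmxE g1 unitr1.
move=> i j k; rewrite invmx_adj //.
case: j => -[|[|//]] jp; case: k => -[|[|//]] kp //= _.
by rewrite -(gA i); congr (fun_of_matrix _ _ _); exact: val_inj.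
Qed.

Lemma irreducible_no_common_eigenrow (Gamma : groupType) (eps : 'I_n -> Gamma)
    (rho : Gamma -> 'M[C]_2) :
  generates eps -> SL2_representation rho ->
  irreducible_rep rho -> ~ common_eigenrow (rho \o eps).
Proof.
move=> gen [rho1 rhoM rhoS] irr [x [y [xy0 Axy]]]; apply: irr.
have v0 : eigencol x y != 0 by rewrite eigencol_eq0 negb_and.
exists <[eigencol x y]>%VS; split.
- by rewrite -dimv_eq0 dim_vline v0.
- apply: contraTneq isT => e; have := dim_vline (eigencol x y).
  by rewrite e dimvf /dim /= v0.
move=> g _ /vlineP[k ->]; rewrite -scalemxAr memvZ //.
(* The elements scaling the eigencolumn contain the generators and are closed under the group
   operations, so the line is invariant under all of [Gamma]. *)
pose P : set Gamma := [set h | exists l, rho h *m eigencol x y = l *: eigencol x y].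
have [l ->] : P g.
  apply: (gen P).
  - by exists 1; rewrite rho1 mul1mx scale1r.
  - move=> h h' [l hl] [l' hl']; exists (l' * l).
    by rewrite rhoM -mulmxA hl' -scalemxAr hl scalerA.
  - move=> h [l hl]; exists l^-1.
    have hK : rho h^-1%g *m rho h = 1%:M by rewrite -rhoM mulVg.
    have l0 : l != 0.
      apply: contra_eq_neq hl => ->; rewrite scale0r; apply: contra_neq v0 => e.
      by rewrite -[eigencol x y]mul1mx -hK -mulmxA e mulmx0.
    apply: (scalerI l0); rewrite scalerA mulfV // scale1r scalemxAr -hl.
    by rewrite mulmxA hK mul1mx.
  - by move=> i; apply/(eigenformP _ xy0)/Axy.
by rewrite memvZ // memv_line.
Qed.

(** A proper nonzero subspace of the plane is a line, spanned by [vpick W]. The row annihilating it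
    is a common eigenrow. *)
Lemma no_common_eigenrow_irreducible (Gamma : groupType) (eps : 'I_n -> Gamma)
    (rho : Gamma -> 'M[C]_2) :
  ~ common_eigenrow (rho \o eps) -> irreducible_rep rho.
Proof.
move=> noeig [W [W0 Wf Winv]]; apply: noeig.
have v0 : vpick W != 0 by rewrite vpick0.
have WE : W = <[vpick W]>%VS.
  apply/eqP; rewrite eq_sym eqEdim -memvE memv_pick dim_vline v0 /=.
  have : (\dim W < \dim {:'cV[C]_2})%N.
    rewrite ltnNge; apply: contra Wf => dW.
    by rewrite eqEdim subvf.
  by rewrite dimvf /dim /= ltnS.
set v := vpick W in v0 WE; rewrite [v]eigencolE eigencol_eq0 negb_and in v0.
exists (v 1 0), (- v 0 0); split=> // i; apply/(eigenformP _ v0); rewrite -eigencolE.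
by apply/vlineP; rewrite -WE; apply: Winv; rewrite memv_pick.
Qed.

End Irreducibility.

(** * Continuity, compactness and properness of the orbit map *)

Section Topology.
Variable R : realType.
Local Notation C := R[i].

Lemma continuous_fcomp (T U V : topologicalType) (f : T -> U) (g : U -> V) :
  continuous f -> continuous g -> continuous (fun x => g (f x)).
Proof. by move=> cf cg x; exact: (continuous_comp (cf x) (cg (f x))). Qed.

(** The topology of [C] is copied from [C^o], so the normed module result applies once its codomain
    is given as [C^o]. *)
Lemma complex_continuousD (T : topologicalType) (f g : T -> C) :
  continuous f -> continuous g -> continuous (fun x => f x + g x).
Proof. by move=> cf cg x; exact: (@continuousD C C^o T f g x (cf x) (cg x)). Qed.

Lemma complex_continuousN (T : topologicalType) (f : T -> C) :
  continuous f -> continuous (fun x => - f x).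
Proof. by move=> cf x; exact: (@continuousN C C^o T f x (cf x)). Qed.

Lemma complex_continuousM (T : topologicalType) (f g : T -> C) :
  continuous f -> continuous g -> continuous (fun x => f x * g x).
Proof. by move=> cf cg x; exact: (@continuousM C T f g x (cf x) (cg x)). Qed.

Lemma complex_hausdorff : hausdorff_space C.
Proof. exact: (@norm_hausdorff C C^o). Qed.

Lemma continuous_complex_of_real : continuous (real_complex R : R -> C).
Proof.
move=> x; apply/(@cvgrPdist_lt C C^o) => e e0.
have eE : e = (complex.Re e)%:C by rewrite RRe_real // gtr0_real.
rewrite eE ltcR in e0 *.
near=> t.
rewrite -rmorphB /= normc_def /= expr0n addr0 sqrtr_sqr eE ltcR.
near: t; by apply: (@cvgr_dist_lt R R^o).
Unshelve. all: by end_near. Qed.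

Lemma continuous_Re : continuous (@complex.Re R : C -> R).
Proof.
move=> x; apply/(@cvgrPdist_lt R R^o C (nbhs x) (nbhs_filter x)) => e e0.
have e0' : 0 < e%:C by rewrite ltcR.
apply: filterS (@cvgr_dist_lt C C^o C (nbhs x) (nbhs_filter x) id x cvg_id _ e0').
move=> t xt; rewrite -ltcR -raddfB; exact: le_lt_trans (normc_ge_Re _) xt.
Qed.

Lemma continuous_Im : continuous (@complex.Im R : C -> R).
Proof.
have -> : @complex.Im R = (fun z : C => complex.Re ((- 'i) * z)).
  by apply/funext => -[a b] /=; simpc.
move=> x; apply: continuous_comp; last exact: continuous_Re.
by apply: complex_continuousM; [exact: cst_continuous|move=> y; exact: cvg_id].
Qed.

(** The squared modulus with values in [R] rather than [C], so that the extreme value theorem and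
    real arithmetic apply to it. *)
Definition sqnorm (z : C) : R := complex.Re z ^+ 2 + complex.Im z ^+ 2.

Lemma continuous_sqnorm : continuous sqnorm.
Proof.
rewrite /sqnorm; under eq_fun do rewrite !expr2.
move=> z; apply: (@continuousD R R^o C); apply: (@continuousM R C).
all: by first [exact: continuous_Re|exact: continuous_Im].
Qed.

Lemma continuous_to_mx (T : topologicalType) m n (f : T -> 'M[C]_(m, n)) :
  (forall i j, continuous (fun x => f x i j)) -> continuous f.
Proof.
move=> cf x B [P Px PB]; rewrite /nbhs/= /fmap/=.
have H : \forall y \near x, forall ij : 'I_m * 'I_n, P ij.1 ij.2 (f y ij.1 ij.2).
  apply: filter_forall => -[i j] /=; exact: (cf i j x _ (Px i j)).
by near=> y; apply: PB => i j; exact: (near H y _ (i, j)).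
Unshelve. all: by end_near. Qed.

Lemma continuous_coord m n i j : continuous (fun M : 'M[C]_(m, n) => M i j).
Proof. exact: (@coord_continuous C). Qed.

Lemma continuous_to_ptws (T : topologicalType) n (f : T -> {ptws 'I_n -> 'M[C]_2}) :
  (forall i, continuous (fun x => f x i)) -> continuous f.
Proof.
move=> cf x; apply/cvg_sup => i.
exact: (@continuous_comp_initial _ _ _ (fun h : 'I_n -> 'M[C]_2 => h i) f (cf i)).
Qed.

Lemma ptws_continuous n (i : 'I_n) : continuous (fun B : {ptws 'I_n -> 'M[C]_2} => B i).
Proof. exact: (@proj_continuous _ (fun=> 'M[C]_2) i). Qed.

Lemma ptws_mx_hausdorff n : hausdorff_space {ptws 'I_n -> 'M[C]_2}.
Proof.
apply: (@hausdorff_product _ (fun=> 'M[C]_2)) => _.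
exact: (@norm_hausdorff C).
Qed.

Lemma compact_bounded_above (T : topologicalType) (f : T -> R) (K : set T) :
  continuous f -> compact K -> exists M, forall x, K x -> f x <= M.
Proof.
move=> cf cK; have [K0|K0] := pselect (K !=set0); last first.
  by exists 0 => x Kx; exfalso; apply: K0; exists x.
have [x _ fx] := compact_EVT_max K0 cK (continuous_subspaceT (A := K) cf).
by exists (f x) => y Ky; apply: fx; rewrite inE.
Qed.

Lemma sqnorm_ge0 z : 0 <= sqnorm z.
Proof. by rewrite addr_ge0 ?sqr_ge0. Qed.

Lemma sqnorm_eq0 z : (sqnorm z == 0) = (z == 0).
Proof. by rewrite paddr_eq0 ?sqr_ge0 // !sqrf_eq0 eq_complex. Qed.

Lemma sqnormM z w : sqnorm (z * w) = sqnorm z * sqnorm w.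
Proof. by case: z => a b; case: w => c d; rewrite /sqnorm /=; ring. Qed.

Lemma sqnorm_real (r : R) : sqnorm r%:C = r ^+ 2.
Proof. by rewrite /sqnorm /= expr0n addr0. Qed.

Lemma sqnormN z : sqnorm (- z) = sqnorm z.
Proof. by case: z => a b; rewrite /sqnorm /= !sqrrN. Qed.

Lemma compact_disc (c : R) : compact [set z | sqnorm z <= c].
Proof.
pose f (p : R * R) : C := p.1%:C + 'i * p.2%:C.
have cf : continuous f.
  apply: complex_continuousD => [p|].
    by apply: continuous_comp; [exact: cvg_fst|exact: continuous_complex_of_real].
  apply: complex_continuousM => [|p]; first exact: cst_continuous.
  by apply: continuous_comp; [exact: cvg_snd|exact: continuous_complex_of_real].
(* A square containing the disc: t^2 <= c gives |t| <= 1 + c, without a square root. *)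
have csq : compact (f @` (`[- (1 + c), 1 + c] `*` `[- (1 + c), 1 + c])).
  apply: continuous_compact; first exact: continuous_subspaceT.
  by apply: compact_setX; exact: segment_compact.
apply: subclosed_compact csq _ => [|z /= zc].
  exact: (preimage_closed (fun x _ => @continuous_sqnorm x) (@closed_le R c)).
exists (complex.Re z, complex.Im z); last by rewrite /f /= -complexE.
have := sqr_ge0 (complex.Re z - 1); have := sqr_ge0 (complex.Re z + 1).
have := sqr_ge0 (complex.Im z - 1); have := sqr_ge0 (complex.Im z + 1).
have := sqr_ge0 (complex.Re z); have := sqr_ge0 (complex.Im z).
rewrite /sqnorm in zc; rewrite /= !in_itv /= => *.
by split; apply/andP; split; nra.
Qed.

Lemma positive_bounded_below (f : C -> R) : continuous f -> (forall z, 0 < f z) ->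
  exists2 m, 0 < m & forall z, sqnorm z <= 1 -> m <= f z.
Proof.
move=> cf fpos; have D0 : [set z | sqnorm z <= 1] !=set0.
  by exists 0; rewrite /= /sqnorm /= expr0n addr0.
have [x _ fx] := compact_EVT_min D0 (compact_disc (c := 1)) (continuous_subspaceT cf).
by exists (f x) => // z z1; apply: fx; rewrite inE.
Qed.

Lemma compact_mx2_box (c : R) :
  exists2 B : set 'M[C]_2, compact B &
    forall M : 'M[C]_2, (forall i j, sqnorm (M i j) <= c) -> B M.
Proof.
pose f (p : (C * C) * (C * C)) : 'M[C]_2 := mx2 p.1.1 p.1.2 p.2.1 p.2.2.
pose D : set C := [set z | sqnorm z <= c].
have cD : compact D := compact_disc (c := c).
exists (f @` ((D `*` D) `*` (D `*` D))); last first.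
  move=> M Mc; exists ((M 0 0, M 0 1), (M 1 0, M 1 1)); last by rewrite /f -mx2P.
  by split; split; exact: Mc.
apply: continuous_compact; last by do 2?apply: compact_setX.
apply: continuous_subspaceT; apply: continuous_to_mx => i j.
have cfst (T U : topologicalType) : continuous (fst : T * U -> T).
  by move=> ?; exact: cvg_fst.
have csnd (T U : topologicalType) : continuous (snd : T * U -> U).
  by move=> ?; exact: cvg_snd.
under [X in continuous X]eq_fun do rewrite mxE.
case: (i == 0); case: (j == 0).
- exact: (continuous_fcomp (@cfst _ _) (@cfst _ _)).
- exact: (continuous_fcomp (@cfst _ _) (@csnd _ _)).
- exact: (continuous_fcomp (@csnd _ _) (@cfst _ _)).
- exact: (continuous_fcomp (@csnd _ _) (@csnd _ _)).
Qed.

Lemma continuous_det2 : continuous (fun g : 'M[C]_2 => \det g).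
Proof.
have -> : (fun g : 'M[C]_2 => \det g) =
    fun g => g 0 0 * g 1 1 + - (g 0 1 * g 1 0).
  by apply/funext => g; rewrite {1}[g]mx2P det_mx2.
apply: complex_continuousD; last apply: complex_continuousN;
  by apply: complex_continuousM; exact: continuous_coord.
Qed.

Lemma closed_SL2 : closed (@SL2 R).
Proof.
have c1 : closed [set (1 : C)].
  by apply/accessible_closed_set1/hausdorff_accessible/complex_hausdorff.
exact: (preimage_closed (fun x _ => @continuous_det2 x) c1).
Qed.

Lemma continuous_mulmx2 (f h : 'M[C]_2 -> 'M[C]_2) : continuous f -> continuous h ->
  continuous (fun g => f g *m h g).
Proof.
move=> cf ch; apply: continuous_to_mx => a b.
have cc (u : 'M[C]_2 -> 'M[C]_2) c d : continuous u -> continuous (fun g => u g c d).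
  by move=> cu g; exact: (continuous_comp (cu g) (@continuous_coord _ _ c d (u g))).
have e : (fun g => f g a 0 * h g 0 b + f g a 1 * h g 1 b) =
    fun g => (f g *m h g) a b.
  apply/funext => g; rewrite mxE !big_ord_recl big_ord0 addr0.
  by have -> : lift 0 0 = 1 :> 'I_2 by apply: val_inj.
rewrite -[X in continuous X]e.
by apply: complex_continuousD; apply: complex_continuousM; exact: cc.
Qed.

(* [orbit_map A] on [SL2], but polynomial, hence continuous, everywhere. *)
Definition adj_orbit_map n (A : 'I_n -> 'M[C]_2) (g : 'M[C]_2) :
  {ptws 'I_n -> 'M[C]_2} := fun i => g *m A i *m \adj g.

Lemma continuous_adj_orbit_map n (A : 'I_n -> 'M[C]_2) :
  continuous (adj_orbit_map A).
Proof.
apply: continuous_to_ptws => i; apply: continuous_to_mx => j k.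
have cN : continuous (fun g : 'M[C]_2 => \adj g).
  apply: continuous_to_mx => a b.
  have -> : (fun g : 'M[C]_2 => (\adj g) a b) =
      fun g => mx2 (g 1 1) (- g 0 1) (- g 1 0) (g 0 0) a b.
    by apply/funext => g; rewrite {1}[g]mx2P adj_mx2.
  under [X in continuous X]eq_fun do rewrite mxE.
  case: (a == 0); case: (b == 0);
    by [exact: continuous_coord|apply: complex_continuousN; exact: continuous_coord].
have cf : continuous (fun g : 'M[C]_2 => g *m A i *m \adj g).
  apply: (continuous_mulmx2 _ cN).
  apply: (continuous_mulmx2 (f := fun g => g)) => [g|]; first exact: cvg_id.
  exact: cst_continuous.
by move=> g; exact: (continuous_comp (cf g) (@continuous_coord _ _ j k _)).
Qed.

(** The sum is positive off the origin and homogeneous, so it suffices to bound it below on the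
    projective line. That line is covered by the unit discs of the two charts (1 : z) and (z : 1),
    which are compact. *)
Lemma eigenform_coercive n (A : 'I_n -> 'M[C]_2) : ~ common_eigenrow A ->
  exists2 m, 0 < m & forall x y,
    m * sqnorm x ^+ 2 <= \sum_i sqnorm (eigenform (A i) x y) /\
    m * sqnorm y ^+ 2 <= \sum_i sqnorm (eigenform (A i) x y).
Proof.
move=> noeig.
have posF x y : (x != 0) || (y != 0) -> 0 < \sum_i sqnorm (eigenform (A i) x y).
  move=> xy0; rewrite lt_neqAle sumr_ge0 => [|i _]; last exact: sqnorm_ge0.
  rewrite andbT eq_sym; apply: contra_notN noeig.
  rewrite psumr_eq0 => [/allP A0|i _]; last exact: sqnorm_ge0.
  exists x, y; split=> // i; apply/eqP; rewrite -sqnorm_eq0.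
  by apply: A0; rewrite mem_index_enum.
have csum (T : topologicalType) (f : 'I_n -> T -> C) : (forall i, continuous (f i)) ->
    continuous (fun z => \sum_i sqnorm (f i z)).
  move=> cf; apply: (@continuous_big _ _ _ _ _ add_continuous) => i _ z.
  exact: (continuous_comp (cf i z) (@continuous_sqnorm _)).
have cid : continuous (fun z : C => z) by move=> z; exact: cvg_id.
have ccst (c : C) : continuous (fun _ : C => c) by exact: cst_continuous.
have cq (f g : C -> C) i : continuous f -> continuous g ->
    continuous (fun z => eigenform (A i) (f z) (g z)).
  move=> cf cg; rewrite /eigenform; under eq_fun do rewrite !expr2.
  apply: complex_continuousD; last first.
    by apply/complex_continuousN/complex_continuousM/ccst/complex_continuousM.
  apply: complex_continuousD; apply: complex_continuousM; try exact: ccst.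
    exact: (complex_continuousM cf cf).
  exact: (complex_continuousM cf cg).
have [m1 m1_gt0 Hm1] := positive_bounded_below
  (csum _ _ (fun i => cq _ _ i (ccst 1) cid))
  (fun z => posF 1 z (introT orP (or_introl (oner_neq0 _)))).
have [m2 m2_gt0 Hm2] := positive_bounded_below
  (csum _ _ (fun i => cq _ _ i cid (ccst 1)))
  (fun z => posF z 1 (introT orP (or_intror (oner_neq0 _)))).
(* Homogeneity of degree 4 in the modulus; it allows division by the larger of the two
   coordinates. *)
have scale x y c : \sum_i sqnorm (eigenform (A i) (c * x) (c * y)) =
    sqnorm c ^+ 2 * \sum_i sqnorm (eigenform (A i) x y).
  rewrite mulr_sumr; apply: eq_bigr => i _.
  by rewrite expr2 -!sqnormM; congr sqnorm; rewrite /eigenform; ring.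
have m_gt0 : 0 < Num.min m1 m2 by rewrite lt_min m1_gt0.
exists (Num.min m1 m2) => // x y.
suff H : Num.min m1 m2 * Num.max (sqnorm x) (sqnorm y) ^+ 2 <=
    \sum_i sqnorm (eigenform (A i) x y).
  split; apply: le_trans H;
    by rewrite ler_pM2l // ler_sqr ?nnegrE ?le_max ?sqnorm_ge0 ?lexx ?orbT.
have [xy|/ltW yx] := leP (sqnorm x) (sqnorm y).
  have [y0|y0] := eqVneq y 0.
    rewrite y0 /sqnorm /= !expr0n /= addr0 expr0n mulr0.
    by rewrite sumr_ge0 // => i _; exact: sqnorm_ge0.
  have := scale (x / y) 1 y; rewrite mulr1 [y * _]mulrC divfK // => ->.
  rewrite mulrC ler_wpM2l ?sqr_ge0 // ge_min Hm2 ?orbT //.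
  have ny : 0 < sqnorm y by rewrite lt_neqAle eq_sym sqnorm_eq0 y0 sqnorm_ge0.
  by rewrite -(ler_pM2r ny) -sqnormM divfK // mul1r.
have [x0|x0] := eqVneq x 0.
  rewrite x0 /sqnorm /= !expr0n /= addr0 expr0n mulr0.
  by rewrite sumr_ge0 // => i _; exact: sqnorm_ge0.
have := scale 1 (y / x) x; rewrite mulr1 [x * _]mulrC divfK // => ->.
rewrite mulrC ler_wpM2l ?sqr_ge0 // ge_min Hm1 //.
have nx : 0 < sqnorm x by rewrite lt_neqAle eq_sym sqnorm_eq0 x0 sqnorm_ge0.
by rewrite -(ler_pM2r nx) -sqnormM divfK // mul1r.
Qed.

Lemma no_common_eigenrow_stable n (A : 'I_n -> 'M[C]_2) :
  ~ common_eigenrow A -> stable A.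
Proof.
move=> /eigenform_coercive[m m0 Hm] K cK KS.
pose f := adj_orbit_map A.
have -> : @SL2 R `&` orbit_map A @^-1` K = @SL2 R `&` f @^-1` K.
  by apply/seteqP; split=> g [g1 Kg]; split=> //; move: Kg;
    rewrite /f /adj_orbit_map /orbit_map /= invmx_adj.
(* Only off-diagonal entries are measured: on the orbit they are, up to sign, the eigenforms at the
   two rows of the conjugating matrix. *)
pose F (B : {ptws 'I_n -> 'M[C]_2}) : R :=
  \sum_i sqnorm (B i 0 1) + \sum_i sqnorm (B i 1 0).
have csum j k : continuous (fun B : {ptws 'I_n -> 'M[C]_2} => \sum_i sqnorm (B i j k)).
  apply: (@continuous_big _ _ _ _ _ add_continuous) => i _.
  have cj := continuous_fcomp (@ptws_continuous n i) (@continuous_coord 2 2 j k).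
  exact: (continuous_fcomp cj continuous_sqnorm).
have cF : continuous F.
  by move=> B; apply: (@continuousD R R^o); exact: csum.
have [M FM] := compact_bounded_above cF cK.
(* Coercivity will give m a^2 <= M for the squared modulus a of each entry of g, and a <= 1 +
   a^2. *)
have [B cB Bbox] := compact_mx2_box (1 + M / m).
apply: subclosed_compact cB _.
  apply: closedI; first exact: closed_SL2.
  apply: (preimage_closed (fun x _ => @continuous_adj_orbit_map _ A x)).
  by apply: compact_closed cK; exact: ptws_mx_hausdorff.
move=> g [_ Kg]; apply: Bbox.
have := FM _ Kg; rewrite /F /f /adj_orbit_map.
under eq_bigr do rewrite conj_adj01.
under [X in _ + X]eq_bigr do rewrite conj_adj10 sqnormN.
set S1 := (X in X + _); set S2 := (X in _ + X) => SM.
have S1_ge0 : 0 <= S1 by rewrite sumr_ge0 // => i _; exact: sqnorm_ge0.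
have S2_ge0 : 0 <= S2 by rewrite sumr_ge0 // => i _; exact: sqnorm_ge0.
have bound (a S : R) : m * a ^+ 2 <= S -> S <= M -> a <= 1 + M / m.
  move=> maS SM'; have : a ^+ 2 <= M / m.
    by rewrite ler_pdivlMr // mulrC; exact: le_trans SM'.
  by have := sqr_ge0 (a - 1); have := sqr_ge0 a; nra.
have S1M : S1 <= M by apply: le_trans SM; rewrite lerDl.
have S2M : S2 <= M by apply: le_trans SM; rewrite lerDr.
move=> i j; rewrite [g]mx2P mxE.
have [r1 r2] := Hm (g 0 0) (g 0 1); have [r3 r4] := Hm (g 1 0) (g 1 1).
by case: (i == 0); case: (j == 0); [exact: bound r1 S1M|exact: bound r2 S1M
  |exact: bound r3 S2M|exact: bound r4 S2M].
Qed.

Lemma stable_no_common_eigenrow n (A : 'I_n -> 'M[C]_2) :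
  (forall i, \det (A i) = 1) -> stable A -> ~ common_eigenrow A.
Proof.
move=> detA stA /common_eigenrow_SL2[g g1 gA].
pose U i := g *m A i *m \adj g.
have detU i : U i 0 0 * U i 1 1 = 1.
  have adj1 : \det (\adj g) = 1.
    by have := congr1 determinant (mul_mx_adj g); rewrite det_mulmx g1 mul1r det1.
  have dU : \det (U i) = 1 by rewrite !det_mulmx g1 detA adj1 !mulr1.
  by rewrite -[RHS]dU [in RHS](mx2P (U i)) det_mx2 [U i 1 0]gA mulr0 subr0.
(* The arc shrinks the upper right entries of the triangular conjugates to 0 and stays in SL2. *)
pose path (s : R) : {ptws 'I_n -> 'M[C]_2} :=
  fun i => mx2 (U i 0 0) (s%:C * U i 0 1) 0 (U i 1 1).
have cpath : continuous path.
  apply: continuous_to_ptws => i; apply: continuous_to_mx => j k.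
  under [X in continuous X]eq_fun do rewrite mxE.
  case: (j == 0); case: (k == 0); try exact: cst_continuous.
  apply: complex_continuousM; last exact: cst_continuous.
  exact: continuous_complex_of_real.
have cK : compact (path @` `[0, 1]).
  by apply: continuous_compact; [exact: continuous_subspaceT|exact: segment_compact].
have KS : path @` `[0, 1] `<=` @SL2n R n.
  by move=> _ [s _ <-] i; rewrite /SL2 /path /= det_mx2 mulr0 subr0.
(* At h = diag(1/r, r) g this function equals r^2, so it detects the escape to infinity that
   compactness forbids. *)
have cp : continuous (fun h : 'M[C]_2 => sqnorm ((h *m \adj g) 1 1)).
  have e : (fun h : 'M[C]_2 => (h *m \adj g) 1 1) =
      (fun h : 'M[C]_2 => h 1 0 * (\adj g) 0 1 + h 1 1 * (\adj g) 1 1 : C).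
    apply/funext => h; rewrite mxE !big_ord_recl big_ord0 addr0.
    by have -> : lift 0 0 = 1 :> 'I_2 by apply: val_inj.
  have ce : continuous (fun h : 'M[C]_2 => (h *m \adj g) 1 1).
    rewrite e; apply: complex_continuousD; apply: complex_continuousM;
      by [exact: continuous_coord|exact: cst_continuous].
  by move=> h; exact: (continuous_comp (ce h) (@continuous_sqnorm _)).
have [M HM] := compact_bounded_above cp (stA _ cK KS).
(* Chosen so that r >= 1 and r > M, whence r^2 > M. *)
pose r := 1 + `|M|.
have r1 : 1 <= r by rewrite lerDl.
have r0 : r != 0 by rewrite gt_eqF // (lt_le_trans ltr01 r1).
pose d : 'M[C]_2 := mx2 (r^-1)%:C 0 0 r%:C.
have dg1 : \det (d *m g) = 1.
  by rewrite det_mulmx g1 mulr1 det_mx2 mulr0 subr0 -rmorphM mulVf.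
have gV : g *m \adj g = 1%:M by rewrite mul_mx_adj g1.
have : sqnorm ((d *m g *m \adj g) 1 1) <= M.
  (* Conjugation by [d] multiplies the upper right entries by r^-2 and fixes the diagonal, so it
     lands on the arc at s = r^-2. *)
  apply: HM; split=> //=; exists (r^-1 ^+ 2).
    rewrite /= in_itv /= sqr_ge0 exprn_ile1 ?invr_ge0 ?invf_le1 //.
      exact: le_trans ler01 r1.
    exact: lt_le_trans ltr01 r1.
  apply/funext => i; rewrite /orbit_map invmx_adj //.
  have -> : \adj (d *m g) = \adj g *m \adj d.
    by rewrite [d]mx2P [g]mx2P !mul_mx2 !adj_mx2 !mul_mx2; congr mx2; ring.
  have -> : d *m g *m A i *m (\adj g *m \adj d) = d *m U i *m \adj d.
    by rewrite /U !mulmxA.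
  rewrite (mx2P (U i)) [U i 1 0]gA adj_mx2 !mul_mx2 /path.
  have rV : (r%:C)^-1 = (r^-1)%:C by rewrite fmorphV.
  have r0' : r%:C != 0 by rewrite fmorph_eq0.
  by rewrite expr2 rmorphM -rV; congr mx2; field.
rewrite -mulmxA gV mulmx1 mx2E sqnorm_real.
have M_r : M < r by rewrite ltr_pwDl // ler_norm.
have rr : r <= r ^+ 2 by rewrite expr2 ler_peMl // (le_trans ler01 r1).
by move=> rM; have := lt_le_trans M_r (le_trans rr rM); rewrite ltxx.
Qed.

End Topology.

(** * The invariants of pairs and triples of components *)

Section Invariants.
Variables (R : realType) (n : nat) (A : 'I_n -> 'M[R[i]]_2).

Lemma common_eigenrow_triple j k l :
  common_eigenrow A -> common_eigenrow (triple (A j) (A k) (A l)).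
Proof.
move=> [x [y [xy0 Axy]]]; exists x, y; split=> //.
by case=> -[|[|[|//]]] tp; rewrite /triple /=.
Qed.

(** A common eigenrow would give the traces their values on upper triangular triples, where both
    invariants vanish. *)
Lemma nonzero_invariant_triple j k l : (forall i, \det (A i) = 1) ->
  sigma A j k <> 0 \/ Delta A j k l <> 0 ->
  ~ common_eigenrow (triple (A j) (A k) (A l)).
Proof.
move=> detA inv [x [y [xy0 Axy]]].
have Aj := Axy 0; have Ak := Axy 1; have Al := Axy (inord 2).
rewrite /triple /= in Aj Ak; rewrite /triple inordK //= in Al.
have [s0 D0] := upper_triangular_invariants xy0
  (detA j) (detA k) (detA l) Aj Ak Al.
by case: inv; apply; rewrite /sigma /Delta ?s0 ?D0 subrr ?expr0n.
Qed.

Lemma no_common_eigenrow_invariant : (forall i, \det (A i) = 1) ->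
  ~ common_eigenrow A -> exists j k l, sigma A j k <> 0 \/ Delta A j k l <> 0.
Proof.
move=> detA noeig; apply: contrapT => noinv; apply: noeig.
apply: common_eigenrow_of_invariants => // [j k|j k l]; apply/eqP;
  rewrite -subr_eq0; apply/negPn/negP => /eqP ne; apply: noinv.
  (* [sigma] ignores the third index, so [j] fills it. *)
  by exists j, k, j; left.
by exists j, k, l; right=> /eqP; rewrite sqrf_eq0 => /eqP.
Qed.

End Invariants.

Theorem theorem4p2 (R : realType) (Gamma : groupType) (n : nat)
  (eps : 'I_n -> Gamma) (rho : Gamma -> 'M[R[i]]_2) :
  generates eps ->
  SL2_representation rho ->
  let A := fun i : 'I_n => rho (eps i) in
  [<-> stable A;
       exists j k l : 'I_n, stable (triple (A j) (A k) (A l));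
       exists j k l : 'I_n, sigma A j k <> 0%R \/ Delta A j k l <> 0%R;
       ~ similar_to_upper_triangular A;
       irreducible_rep rho].
Proof.
move=> gen rep A.
have detA i : \det (A i) = 1 by case: rep => _ _ S; exact: S.
have detA3 j k l t : \det (triple (A j) (A k) (A l) t) = 1.
  by case: t => -[|[|[|//]]] tp; rewrite /triple /=.
tfae.
(* The descent from n matrices to three goes through the invariants: a nonzero one involves at most
   three components and already excludes a common eigenrow for them. *)
- move=> /(stable_no_common_eigenrow detA)/(no_common_eigenrow_invariant detA).
  move=> [j [k [l jkl]]]; exists j, k, l; apply: no_common_eigenrow_stable.
  exact: nonzero_invariant_triple.
(* A common eigenrow of all components would be one of the stable triple. The invariant obtained may
   sit at other indices than this triple. *)
- move=> [j [k [l /(stable_no_common_eigenrow (detA3 j k l)) noeig]]].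
  apply: no_common_eigenrow_invariant => //; apply: contra_not noeig.
  exact: common_eigenrow_triple.
- move=> [j [k [l /(nonzero_invariant_triple detA)]]]; apply: contra_not.
  by move=> /similar_common_eigenrow; exact: common_eigenrow_triple.
- move=> nsim; apply: (@no_common_eigenrow_irreducible _ _ _ eps).
  by apply: contra_not nsim; exact: common_eigenrow_similar.
- move=> irr; apply: no_common_eigenrow_stable.
  exact: (irreducible_no_common_eigenrow gen rep irr).
Qed.
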